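(* Let $H$ be an infinite-dimensional separable complex Hilbert space and $\phi : P_\infty(H) \to P_\infty(H)$ a surjective map such that $$\inf\{\angle(x,y) : x \in \mathrm{Im}\,P,\ y \in \mathrm{Im}\,Q,\ \|x\|=\|y\|=1\} = \inf\{\angle(x,y) : x \in \mathrm{Im}\,\phi(P),\ y \in \mathrm{Im}\,\phi(Q),\ \|x\|=\|y\|=1\}$$ for every $P,Q \in P_\infty(H)$. Then there exists a unitary or antiunitary operator $U : H \to H$ such that $$\phi(P) = UPU^\ast$$ for all $P \in P_\infty(H)$.
   Context: ''Projection'' means orthogonal projection (bounded self-adjoint idempotent). $P_\infty(H)$ is the set of all projections on $H$ whose image and kernel are both infinite-dimensional; $\mathrm{Im}\,P$ is the image of $P$. For unit vectors $x,y\in H$, $\angle(x,y) = \arccos|\langle x,y\rangle| \in [0,\pi/2]$. A unitary operator is a surjective linear map $U:H\to H$ with $\langle Ux,Uy\rangle = \langle x,y\rangle$ for all $x,y$; an antiunitary operator is a surjective conjugate-linear map with $\langle Ux,Uy\rangle = \langle y,x\rangle$ for all $x,y$. For conjugate-linear $U$, $U^\ast$ is the conjugate-linear map with $\langle Ux,y\rangle = \overline{\langle x,U^\ast y\rangle}$. In both cases, $UPU^\ast$ is the orthogonal projection onto $U(\mathrm{Im}\,P)$. *)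

(* Defs.v *)
From HB Require Import structures.
From mathcomp Require Import all_boot all_order all_algebra.
From mathcomp Require Import sesquilinear complex.
From mathcomp Require Import all_classical all_reals all_analysis.
Import Order.TTheory GRing.Theory Num.Theory.
Import numFieldNormedType.Exports.

Set Implicit Arguments.
Unset Strict Implicit.
Unset Printing Implicit Defensive.

Local Open Scope classical_set_scope.
Local Open Scope complex_scope.
Local Open Scope ring_scope.

Definition separable (T : topologicalType) : Prop :=
  exists2 D : set T, countable D & dense D.

Section Hilbert.
Context {R : realType} {H : completeNormedModType R[i]}.
Implicit Types (A : set H) (P Q U V : H -> H).

(* Only meant for sets A that are linear subspaces of H. *)
Definition finite_dim A : Prop :=
  exists (n : nat) (e : 'I_n -> H),
    A = range (fun c : 'I_n -> R[i] => \sum_(i < n) c i *: e i).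

Definition infinite_dim A : Prop := ~ finite_dim A.

Definition ker P : set H := P @^-1` [set 0].

Definition bounded_operator P : Prop :=
  linear P /\ exists M : R, forall x, `|P x| <= M%:C * `|x|.

Definition antilinear U : Prop :=
  forall (a : R[i]) (x y : H), U (a *: x + y) = Num.conj a *: U x + U y.

Definition surjective_operator U : Prop := set_surj [set: H] [set: H] U.

(* {dot H for Num.conj} is linear in its first argument. *)
Variable dot : {dot H for @Num.conj R[i]}.

Definition is_adjoint U V : Prop :=
  linear V /\ forall x y, dot (U x) y = dot x (V y).

Definition is_antiadjoint U V : Prop :=
  antilinear V /\ forall x y, dot (U x) y = Num.conj (dot x (V y)).

Definition is_projection P : Prop :=
  [/\ bounded_operator P, is_adjoint P P & idempotent_fun P].

Definition P_infty : set (H -> H) :=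
  [set P | [/\ is_projection P,
               infinite_dim (range P) & infinite_dim (ker P)]].

(* The norm of a complex number lives in R[i]; Re extracts it as a real. *)
Definition angle (x y : H) : R := acos (complex.Re `|dot x y|).

Definition unit_vectors A : set H := [set x | A x /\ `|x| = 1].

Definition inf_angle P Q : R :=
  inf [set angle x y | x in unit_vectors (range P)
                     & y in unit_vectors (range Q)].

Definition unitary U : Prop :=
  [/\ surjective_operator U, linear U
    & forall x y, dot (U x) (U y) = dot x y].

Definition antiunitary U : Prop :=
  [/\ surjective_operator U, antilinear U
    & forall x y, dot (U x) (U y) = dot y x].

End Hilbert.

(* Main.v *)
(* The minimal angle between P and Q is pi/2 exactly when P and Q are
   orthogonal, so phi preserves orthogonality in both directions, hence the
   order, complements and orthogonal sums.  If x is a unit vector orthogonal to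
   P, then P + x covers P, hence phi (P + x) = phi P + y for a line y, and y
   does not depend on P: any two projections orthogonal to x are linked by
   enlarging and shrinking through projections spanned by subsequences of one
   orthonormal sequence.  This defines a map on lines.  It preserves
   |<x1, x2>|: take P1 and P2 orthogonal to each other and to x1 and x2; then
   the angle between P1 + x1 and P2 + x2 is that between the lines x1 and x2.
   By Wigner's theorem the map on lines comes from a unitary or antiunitary U,
   and U (ker P) is contained in ker (phi P) for all P, which applied to P and
   1 - P gives phi P o U = U o P. *)
Require Import Defs.
From HB Require Import structures.
From mathcomp Require Import all_boot all_order all_algebra.
From mathcomp Require Import sesquilinear complex.
From mathcomp Require Import all_classical all_reals all_analysis.
From mathcomp Require Import ring.
Import Order.TTheory GRing.Theory Num.Theory.
Import numFieldNormedType.Exports.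

Set Implicit Arguments.
Unset Strict Implicit.
Unset Printing Implicit Defensive.

Local Open Scope classical_set_scope.
Local Open Scope complex_scope.
Local Open Scope ring_scope.

(** * Inner products and the equality case of Cauchy-Schwarz *)

Section InnerProduct.
Context {C : numClosedFieldType} {H : lmodType C}.
Variable dot : {dot H for @Num.conj C}.
Implicit Types (x y z u v w e : H) (a c : C).

Lemma dotC x y : dot x y = Num.conj (dot y x).
Proof. by rewrite hermC expr0 mul1r. Qed.

Lemma dotDl x y z : dot (x + y) z = dot x z + dot y z.
Proof. exact: linearDl. Qed.

Lemma dotDr x y z : dot z (x + y) = dot z x + dot z y.
Proof. exact: linearDr. Qed.

Lemma dotBl x y z : dot (x - y) z = dot x z - dot y z.
Proof. exact: linearBl. Qed.

Lemma dotBr x y z : dot z (x - y) = dot z x - dot z y.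
Proof. exact: linearBr. Qed.

Lemma dotZl a x y : dot (a *: x) y = a * dot x y.
Proof. exact: linearZl_LR. Qed.

Lemma dotZr a x y : dot x (a *: y) = Num.conj a * dot x y.
Proof. exact: linearZr_LR. Qed.

Lemma dot0l x : dot 0 x = 0.
Proof. exact: linear0l. Qed.

Lemma dot0r x : dot x 0 = 0.
Proof. exact: linear0r. Qed.

Lemma dot_suml I (r : seq I) (P : pred I) (F : I -> H) x :
  dot (\sum_(i <- r | P i) F i) x = \sum_(i <- r | P i) dot (F i) x.
Proof. by elim/big_rec2: _ => [|i _ s _ <-]; rewrite (dot0l, dotDl). Qed.

Lemma dot_sumr I (r : seq I) (P : pred I) (F : I -> H) x :
  dot x (\sum_(i <- r | P i) F i) = \sum_(i <- r | P i) dot x (F i).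
Proof. by elim/big_rec2: _ => [|i _ s _ <-]; rewrite (dot0r, dotDr). Qed.

Lemma dot_eq0C x y : dot x y = 0 -> dot y x = 0.
Proof. by rewrite dotC => /eqP; rewrite conjC_eq0 => /eqP. Qed.

Lemma dotxx_eq0 x : dot x x = 0 -> x = 0.
Proof. by move/eqP; rewrite dnorm_eq0 => /eqP. Qed.

Lemma dot_conjxx x : Num.conj (dot x x) = dot x x.
Proof. by rewrite -dotC. Qed.

Lemma norm_dotC x y : `|dot x y| = `|dot y x|.
Proof. by rewrite dotC norm_conjC. Qed.

Lemma dot_extl x y : (forall z, dot x z = dot y z) -> x = y.
Proof.
move=> xy; apply/eqP; rewrite -subr_eq0; apply/eqP; apply: dotxx_eq0.
by rewrite dotBl xy subrr.
Qed.

Lemma unit_neq0 x : dot x x = 1 -> x != 0.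
Proof. by move=> x1; apply/eqP => x0; move/eqP: x1; rewrite x0 dot0l eq_sym oner_eq0. Qed.

Lemma dot_normalize x : x != 0 ->
  dot ((sqrtC (dot x x))^-1 *: x) ((sqrtC (dot x x))^-1 *: x) = 1.
Proof.
move=> x0; rewrite dnormZ normfV exprVn ger0_norm ?sqrtC_ge0 ?dnorm_ge0//.
by rewrite sqrtCK mulVf// dnorm_eq0.
Qed.

(** Pythagoras for the component of [y] orthogonal to [x]: its nonnegativity gives Cauchy-Schwarz,
    its vanishing the equality case. *)
Lemma dot_sub_proj x y : dot x x != 0 ->
  dot (y - (dot y x / dot x x) *: x) (y - (dot y x / dot x x) *: x)
  = dot y y - `|dot x y| ^+ 2 / dot x x.
Proof.
move=> x0; rewrite dotBl !dotBr !dotZl !dotZr rmorphM fmorphV /= dot_conjxx.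
by rewrite normCK -!dotC; field.
Qed.

Lemma cauchy_schwarz x y : `|dot x y| ^+ 2 <= dot x x * dot y y.
Proof.
have [->|x0] := eqVneq x 0; first by rewrite !dot0l normr0 expr0n mul0r.
have := dnorm_ge0 dot (y - (dot y x / dot x x) *: x).
rewrite dot_sub_proj ?dnorm_eq0// subr_ge0 ler_pdivrMr ?dnorm_gt0//.
by rewrite mulrC.
Qed.

Lemma cauchy_schwarz_eq x y : dot y y = dot x x -> `|dot x y| = dot x x ->
  exists2 c, `|c| = 1 & y = c *: x.
Proof.
move=> yx exy; have [x0|x0] := eqVneq x 0.
  exists 1; rewrite ?normr1// scale1r x0; apply: dotxx_eq0.
  by rewrite yx x0 dot0l.
have xx0 : dot x x != 0 by rewrite dnorm_eq0.
exists (dot y x / dot x x).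
  by rewrite normrM normfV norm_dotC exy ger0_norm ?dnorm_ge0// divff.
apply/eqP; rewrite -subr_eq0; apply/eqP; apply: dotxx_eq0.
by rewrite dot_sub_proj// exy yx expr2 mulfK// subrr.
Qed.

End InnerProduct.

(** * Wigner's theorem for maps preserving the modulus of the inner product *)

Section Wigner.
Context {C : numClosedFieldType} {H : lmodType C}.
Variables (dot : {dot H for @Num.conj C}) (f : H -> H) (e : H).
Hypothesis f_dot : forall x y, `|dot (f x) (f y)| = `|dot x y|.
Hypothesis e_unit : dot e e = 1.
Implicit Types (x y z u v w : H) (a c : C).

Let f_norm x : dot (f x) (f x) = dot x x.
Proof. by have := f_dot x x; rewrite !ger0_norm ?dnorm_ge0. Qed.

(* With the phase of f (e + w) chosen so that its component along f e is f e
   itself, V w is the component orthogonal to f e. *)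
Variable V : H -> H.
Hypothesis V_split : forall w, dot w e = 0 ->
  exists2 c, `|c| = 1 & f e + V w = c *: f (e + w).
Hypothesis V_orth : forall w, dot w e = 0 -> dot (V w) (f e) = 0.

Let V_orthC w : dot w e = 0 -> dot (f e) (V w) = 0.
Proof. by move/V_orth/dot_eq0C. Qed.

Let V_f w x : dot w e = 0 -> `|dot (f e + V w) (f x)| = `|dot (e + w) x|.
Proof. by move=> /V_split[c c1 ->]; rewrite dotZl normrM c1 mul1r f_dot. Qed.

(** Orthogonality to [f e] removes the cross terms of [dot (f e + V w) (f e + V z)], and the phases
    relating these vectors to [f (e + w)] and [f (e + z)] do not affect the modulus. *)
Let V_dot1 w z : dot w e = 0 -> dot z e = 0 ->
  `|1 + dot (V w) (V z)| = `|1 + dot w z|.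
Proof.
move=> we ze; have -> : 1 + dot (V w) (V z) = dot (f e + V w) (f e + V z).
  by rewrite dotDl !dotDr f_norm e_unit V_orthC// V_orth// addr0 add0r.
have [c c1 ->] := V_split ze; rewrite dotZr normrM norm_conjC c1 mul1r V_f//.
by rewrite dotDl !dotDr e_unit we (dot_eq0C ze) addr0 add0r.
Qed.

Let V_norm w : dot w e = 0 -> dot (V w) (V w) = dot w w.
Proof.
move=> we; have := V_dot1 we we.
by rewrite !ger0_norm ?addr_ge0 ?ler01 ?dnorm_ge0// => /addrI.
Qed.

(** [f w] is orthogonal to [f e], so pairing it with [f e + V w] shows that [V w] and [f w] attain
    equality in Cauchy-Schwarz. *)
Let V_par w : dot w e = 0 -> exists2 c, `|c| = 1 & V w = c *: f w.
Proof.
move=> we; apply: (@cauchy_schwarz_eq _ _ dot); first by rewrite V_norm// f_norm.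
have := @V_f w w we.
rewrite dotDl (dot_eq0C (x := f w)); last first.
  by apply/eqP; rewrite -normr_eq0 f_dot we normr0.
rewrite add0r dotDl (dot_eq0C we) add0r norm_dotC => ->.
by rewrite f_norm ger0_norm ?dnorm_ge0.
Qed.

Let V_dot w z : dot w e = 0 -> dot z e = 0 ->
  `|dot (V w) (V z)| = `|dot w z|.
Proof.
move=> /V_par[c c1 ->] /V_par[d d1 ->].
by rewrite dotZl dotZr !normrM norm_conjC c1 d1 !mul1r f_dot.
Qed.

(** The square of [|1 + t|] is [1 + |t|^2 + 2 Re t], so [V_dot1] and [V_dot] together fix the real
    part of the inner product. *)
Let V_re w z : dot w e = 0 -> dot z e = 0 ->
  dot (V w) (V z) + dot (V z) (V w) = dot w z + dot z w.
Proof.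
move=> we ze; rewrite (dotC _ (V z)) (dotC _ z).
have := congr1 (fun t => t ^+ 2) (V_dot1 we ze).
have := congr1 (fun t => t ^+ 2) (V_dot we ze).
rewrite !normCK !rmorphD rmorph1 !mulrDl !mulrDr !mul1r !mulr1 => ->.
by rewrite !addrA => /addIr; rewrite -!addrA => /addrI; rewrite addrC => ->; rewrite addrC.
Qed.

(** Since [V] preserves real parts of inner products, the defect [d] of real linearity has real part
    zero against every [V u]. Being a real combination of such vectors, [d] has real part zero
    against itself. *)
Let V_real a w z : dot w e = 0 -> dot z e = 0 -> a \is Num.real ->
  V (a *: w + z) = a *: V w + V z.
Proof.
move=> we ze /CrealP ar.
have wze : dot (a *: w + z) e = 0 by rewrite dotDl dotZl we ze mulr0 addr0.
set d := V (a *: w + z) - (a *: V w + V z).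
have dE : d = V (a *: w + z) - (a *: V w + V z) by [].
clearbody d; have dV u : dot u e = 0 -> dot d (V u) + dot (V u) d = 0.
  move=> ue; rewrite dE dotBl dotDl dotZl dotBr dotDr dotZr ar.
  have := V_re wze ue; have := V_re we ue; have := V_re ze ue.
  rewrite dotDl dotZl dotDr dotZr ar => h1 h2 h3.
  transitivity ((dot (V (a *: w + z)) (V u) + dot (V u) (V (a *: w + z)))
    - a * (dot (V w) (V u) + dot (V u) (V w))
    - (dot (V z) (V u) + dot (V u) (V z))); first by ring.
  by rewrite h1 h2 h3; ring.
have dd : dot d d + dot d d = 0.
  have -> : dot d d + dot d d =
      (dot d (V (a *: w + z)) + dot (V (a *: w + z)) d)
      - a * (dot d (V w) + dot (V w) d) - (dot d (V z) + dot (V z) d).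
    rewrite {2}dE {2}dE dotBr dotDr dotZr ar dotBl dotDl dotZl; ring.
  by rewrite !dV// mulr0 !subr0.
apply/eqP; rewrite -subr_eq0 -dE; apply/eqP/(@dotxx_eq0 _ _ dot)/eqP.
by move/eqP: dd; rewrite -mulr2n mulrn_eq0.
Qed.

(** The equality case of Cauchy-Schwarz gives [V ('i *: w) = c *: V w] with [c] of modulus 1; by
    [V_re] the real part of [c] is zero. *)
Let V_i w : dot w e = 0 -> V ('i *: w) = 'i *: V w \/ V ('i *: w) = - 'i *: V w.
Proof.
move=> we; have [->|w0] := eqVneq w 0.
  left; rewrite scaler0; suff -> : V 0 = 0 by rewrite scaler0.
  by apply: (@dotxx_eq0 _ _ dot); rewrite V_norm dot0l.
have iwe : dot ('i *: w) e = 0 by rewrite dotZl we mulr0.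
have [] := @cauchy_schwarz_eq _ _ dot (V w) (V ('i *: w)).
- by rewrite !V_norm// dnormZ normCi expr1n mul1r.
- rewrite V_dot// dotZr normrM norm_conjC normCi mul1r V_norm//.
  by rewrite ger0_norm ?dnorm_ge0.
move=> c c1 Vc; have := V_re we iwe; rewrite Vc !dotZl !dotZr conjCi V_norm//.
rewrite mulNr addNr -mulrDl => /eqP; rewrite mulf_eq0 dnorm_eq0 (negPf w0) orbF.
rewrite addr_eq0 => /eqP cc; have : c ^+ 2 = 'i ^+ 2.
  by rewrite sqrCi expr2 -[X in _ * X]opprK mulrN -cc -normCK c1 expr1n.
by move/eqP; rewrite eqf_sqr => /orP[]/eqP ->; [left|right].
Qed.

(** Signs cannot mix: if [w] and [z] have opposite signs, the sign of [w + z] and additivity force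
    [V w] or [V z] to vanish, and then that vector has both signs. *)
Let V_i_uniform : (forall w, dot w e = 0 -> V ('i *: w) = 'i *: V w) \/
  (forall w, dot w e = 0 -> V ('i *: w) = - 'i *: V w).
Proof.
have [|/existsNP[w /not_implyP[we Vw]]] :=
  pselect (forall w, dot w e = 0 -> V ('i *: w) = 'i *: V w); first by left.
right=> z ze; have [Vz|//] := V_i ze.
have {}Vw' : V ('i *: w) = - 'i *: V w by have [/Vw|] := V_i we.
have wze : dot (w + z) e = 0 by rewrite dotDl we ze addr0.
have iwe u : dot u e = 0 -> dot ('i *: u) e = 0 by move=> ue; rewrite dotZl ue mulr0.
have VD u v : dot u e = 0 -> dot v e = 0 -> V (u + v) = V u + V v.
  by move=> ue ve; rewrite -[u in LHS]scale1r V_real ?rpred1// scale1r.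
have eqN u : 'i *: u = - 'i *: u -> 'i *: u = 0.
  move/eqP; rewrite scaleNr -addr_eq0 -mulr2n -scaler_nat scaler_eq0 pnatr_eq0 /=.
  by move/eqP.
have := V_i wze; rewrite scalerDr !VD ?iwe// Vw' Vz !scalerDr => -[/addIr|/addrI].
  by move/esym/eqN => Vw0; case: Vw; rewrite Vw' scaleNr Vw0 oppr0.
by [].
Qed.

(** * Extension of [V] along [s], later the identity or complex conjugation *)

Section Extension.
Variable s : {rmorphism C -> C}.
Hypothesis s_real : forall a, a \is Num.real -> s a = a.
Hypothesis V_si : forall w, dot w e = 0 -> V ('i *: w) = s 'i *: V w.
Hypothesis s_i : s 'i = 'i \/ s 'i = - 'i.

Let s_conj a : s (Num.conj a) = Num.conj (s a).
Proof.
have sE b c : b \is Num.real -> c \is Num.real -> s (b + 'i * c) = b + s 'i * c.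
  by move=> br cr; rewrite rmorphD rmorphM (s_real br) (s_real cr).
have [ar br] := (Creal_Re a, Creal_Im a).
rewrite [a]Crect conjC_rect// -mulrN !sE ?rpredN//.
rewrite (rmorphD Num.conj) (rmorphM Num.conj) /= (CrealP ar) (CrealP br) mulrN -mulNr.
by case: s_i => ->; rewrite ?rmorphN /= conjCi.
Qed.

Let s_norm a : `|s a| = `|a|.
Proof.
apply/eqP; rewrite -(@eqrXn2 _ 2)//; apply/eqP.
rewrite !normCK -s_conj -rmorphM -normCK s_real//.
Qed.

Let V_lin a w z : dot w e = 0 -> dot z e = 0 ->
  V (a *: w + z) = s a *: V w + V z.
Proof.
move=> we ze; rewrite [a]Crect scalerDl -addrA V_real ?Creal_Re//; last first.
  by rewrite dotDl !dotZl we ze !mulr0 addr0.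
rewrite mulrC -scalerA V_real ?Creal_Im ?dotZl ?we ?mulr0// V_si//.
rewrite rmorphD rmorphM (s_real (Creal_Re a)) (s_real (Creal_Im a)) addrA scalerDl.
by rewrite -[in RHS]scalerA.
Qed.

(** [V_re] at [w] controls the real part and at ['i *: w] the imaginary part; adding the two gives
    twice the inner product. *)
Let V_sdot w z : dot w e = 0 -> dot z e = 0 -> dot (V w) (V z) = s (dot w z).
Proof.
move=> we ze; have iwe : dot ('i *: w) e = 0 by rewrite dotZl we mulr0.
have si0 : s 'i != 0 by case: s_i => ->; rewrite ?oppr_eq0 neq0Ci.
have re_real : dot w z + dot z w \is Num.real.
  by rewrite CrealE (rmorphD Num.conj) /= -!dotC addrC.
have im_real : 'i * (dot w z - dot z w) \is Num.real.
  rewrite CrealE (rmorphM Num.conj) (rmorphB Num.conj) /= conjCi -!dotC.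
  by rewrite mulNr -mulrN opprB.
have h4 := V_re we ze; rewrite -(s_real re_real) (rmorphD s) in h4.
have h3 := V_re iwe ze.
rewrite V_si// !dotZl !dotZr -s_conj conjCi (rmorphN s) /= !mulNr -!mulrBr in h3.
rewrite -(s_real im_real) (rmorphM s) (rmorphB s) in h3.
have {}h3 := mulfI si0 h3.
have : dot (V w) (V z) *+ 2 = s (dot w z) *+ 2.
  by rewrite !mulr2n -{1}(subrK (dot (V z) (V w)) (dot (V w) (V z))) h3 -addrA
    (addrC (dot (V z) _)) h4 addrACA addNr addr0.
by move/eqP; rewrite eqrMn2r // => /eqP.
Qed.

Let U x := s (dot x e) *: f e + V (x - dot x e *: e).

Let rest_orth x : dot (x - dot x e *: e) e = 0.
Proof. by rewrite dotBl dotZl e_unit mulr1 subrr. Qed.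

Lemma wigner_ext : exists U : H -> H,
  [/\ forall a x y, U (a *: x + y) = s a *: U x + U y,
      forall x y, dot (U x) (U y) = s (dot x y)
    & forall x, exists c, U x = c *: f x].
Proof.
exists U.
have U_dot x y : dot (U x) (U y) = s (dot x y).
  rewrite /U dotDl !dotDr !dotZl !dotZr f_norm e_unit V_orth// V_orthC// V_sdot//.
  rewrite !mulr0 addr0 add0r mulr1 -s_conj -rmorphM -rmorphD; congr (s _).
  rewrite dotBl !dotBr !dotZl !dotZr e_unit mulr1 (dotC dot e y).
  by rewrite subrr subr0 mulrC addrC subrK.
split=> //.
- move=> a x y; rewrite /U dotDl dotZl rmorphD rmorphM.
  have -> : a *: x + y - (a * dot x e + dot y e) *: e =
     a *: (x - dot x e *: e) + (y - dot y e *: e).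
    by rewrite scalerBr scalerDl scalerA opprD addrACA.
  by rewrite V_lin// scalerDl scalerDr scalerA addrACA.
- move=> x.
  (* That [U x] is a multiple of [f x] is again the equality case of Cauchy-Schwarz. *)
  suff h : `|dot (f x) (U x)| = dot x x.
    have [||c _ ->] := @cauchy_schwarz_eq _ _ dot (f x) (U x).
    - by rewrite U_dot f_norm s_real// ger0_real// dnorm_ge0.
    - by rewrite h f_norm.
    by exists c.
  rewrite norm_dotC /U; set l := dot x e; set w := x - l *: e.
  have we : dot w e = 0 by exact: rest_orth.
  have [l0|l0] := eqVneq l 0.
    have -> : w = x by rewrite /w l0 scale0r subr0.
    rewrite l0 rmorph0 scale0r add0r; have [c c1 ->] := V_par l0.
    by rewrite dotZl normrM c1 mul1r f_norm ger0_norm ?dnorm_ge0.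
  (* As [l] is nonzero, [x] is [l] times [e + l^-1 *: w], so [U x] is [s l] times
     [f e + V (l^-1 *: w)], whose product with [f x] is known in modulus from [V_f]. *)
  have lwe : dot (l^-1 *: w) e = 0 by rewrite dotZl we mulr0.
  have -> : V w = s l *: V (l^-1 *: w).
    have V0 : V 0 = 0 by apply: (@dotxx_eq0 _ _ dot); rewrite V_norm dot0l.
    have := @V_lin l (l^-1 *: w) 0 lwe (dot0l _ _).
    by rewrite addr0 V0 addr0 scalerA divff// scale1r.
  rewrite -scalerDr dotZl normrM s_norm V_f// -normrM -dotZl scalerDr scalerA.
  by rewrite divff// scale1r /w addrC subrK ger0_norm ?dnorm_ge0.
Qed.

End Extension.

Lemma wigner_of_split : exists U : H -> H,
  (linear U /\ (forall x y, dot (U x) (U y) = dot x y) \/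
   (forall a x y, U (a *: x + y) = Num.conj a *: U x + U y) /\
   (forall x y, dot (U x) (U y) = dot y x)) /\
  forall x, exists c, U x = c *: f x.
Proof.
have [Vi|Vi] := V_i_uniform.
  have [|||U [U1 U2 U3]] := @wigner_ext idfun; [by []|by []|by left|].
  by exists U; split=> //; left.
have [|||U [U1 U2 U3]] := @wigner_ext (@Num.conj C).
- by move=> a /CrealP.
- by move=> w we; rewrite /= conjCi Vi.
- by right; rewrite /= conjCi.
by exists U; split=> //; right; split=> // x y; rewrite U2 /= -dotC.
Qed.

End Wigner.

Theorem wigner {C : numClosedFieldType} {H : lmodType C}
    (dot : {dot H for @Num.conj C}) (f : H -> H) (e : H) :
  (forall x y, `|dot (f x) (f y)| = `|dot x y|) -> dot e e = 1 ->
  exists U : H -> H,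
  (linear U /\ (forall x y, dot (U x) (U y) = dot x y) \/
   (forall a x y, U (a *: x + y) = Num.conj a *: U x + U y) /\
   (forall x y, dot (U x) (U y) = dot y x)) /\
  forall x, exists c, U x = c *: f x.
Proof.
move=> f_dot e1.
have fe1 : dot (f e) (f e) = 1.
  by have := f_dot e e; rewrite !ger0_norm ?dnorm_ge0// e1.
(* The coefficient of [f (e + w)] along [f e] has modulus 1, so dividing by it only corrects the
   phase. *)
have n1 w : dot w e = 0 -> `|dot (f (e + w)) (f e)| = 1.
  by move=> we; rewrite f_dot dotDl e1 we addr0 normr1.
apply: (@wigner_of_split _ _ _ _ _ f_dot e1
  (fun w => (dot (f (e + w)) (f e))^-1 *: f (e + w) - f e)).
- move=> w /n1 n; exists (dot (f (e + w)) (f e))^-1; first by rewrite normfV n invr1.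
  by rewrite addrC subrK.
- move=> w /n1 n; rewrite dotBl dotZl fe1 mulVf ?subrr//.
  by rewrite -normr_eq0 n oner_eq0.
Qed.

(** * Orthogonal projections, their order, and orthonormal sequences *)

Section Projections.
Context {C : numClosedFieldType} {H : lmodType C}.
Variable dot : {dot H for @Num.conj C}.
Implicit Types (x y z u v w : H) (a : C) (P Q S T : H -> H) (A B : set H).

Definition orthoproj P : Prop :=
  (forall x y, dot (P x) y = dot x (P y)) /\ (forall x, P (P x) = P x).

Definition lep P Q : Prop := forall x, Q (P x) = P x.
Definition orthp P Q : Prop := forall x, P (Q x) = 0.

Definition compl P : H -> H := fun x => x - P x.
Definition addp P Q : H -> H := fun x => P x + Q x.
Definition subp P Q : H -> H := fun x => P x - Q x.
Definition line x : H -> H := fun u => dot u x *: x.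

(** Tested against any [z], self-adjointness moves [P] to the other argument, where linearity is
    that of [dot]. *)
Lemma orthoproj_linear P : orthoproj P -> linear P.
Proof.
move=> [Padj _] a x y; apply: (@dot_extl _ _ dot) => z.
by rewrite Padj !dotDl !dotZl !Padj.
Qed.

Section Linearity.
Variables (P : H -> H) (Pproj : orthoproj P).

Lemma orthoprojD x y : P (x + y) = P x + P y.
Proof. by have := orthoproj_linear Pproj 1 x y; rewrite !scale1r. Qed.

Lemma orthoproj0 : P 0 = 0.
Proof. by apply: (addIr (P 0)); rewrite -orthoprojD !add0r. Qed.

Lemma orthoprojZ a x : P (a *: x) = a *: P x.
Proof. by have := orthoproj_linear Pproj a x 0; rewrite orthoproj0 !addr0. Qed.

Lemma orthoprojB x y : P (x - y) = P x - P y.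
Proof. by rewrite orthoprojD -scaleN1r orthoprojZ scaleN1r. Qed.

Lemma orthoproj_sum I (r : seq I) (F : I -> H) :
  P (\sum_(i <- r) F i) = \sum_(i <- r) P (F i).
Proof. by elim/big_rec2: _ => [|i y x _ <-]; rewrite (orthoproj0, orthoprojD). Qed.

Lemma orthoproj_compl : orthoproj (compl P).
Proof.
have [Padj PP] := Pproj; rewrite /compl; split=> [x y|x].
  by rewrite dotBl dotBr Padj.
by rewrite orthoprojB PP subrr subr0.
Qed.

Lemma orthp_compl : orthp P (compl P).
Proof. by move=> x; rewrite /compl orthoprojB (proj2 Pproj) subrr. Qed.

End Linearity.

Lemma orthp_sym P Q : orthoproj P -> orthoproj Q -> orthp P Q -> orthp Q P.
Proof.
move=> [Padj _] [Qadj _] PQ x; apply: (@dot_extl _ _ dot) => z.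
by rewrite Qadj Padj PQ dot0l dot0r.
Qed.

Lemma lep_adj P Q : orthoproj P -> orthoproj Q -> lep P Q -> forall x, P (Q x) = P x.
Proof.
move=> [Padj _] [Qadj _] PQ x; apply: (@dot_extl _ _ dot) => z.
by rewrite Padj Qadj PQ Padj.
Qed.

Lemma adj_lep P Q : orthoproj P -> orthoproj Q -> (forall x, P (Q x) = P x) -> lep P Q.
Proof.
move=> [Padj _] [Qadj _] PQ x; apply: (@dot_extl _ _ dot) => z.
by rewrite Qadj Padj PQ Padj.
Qed.

Lemma lep_refl P : orthoproj P -> lep P P.
Proof. by case. Qed.

Lemma lep_anti P Q : orthoproj P -> orthoproj Q -> lep P Q -> lep Q P -> P = Q.
Proof. by move=> Pp Qp PQ QP; apply/funext => x; rewrite -(lep_adj Pp Qp PQ) QP. Qed.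

Lemma orthp_lep P Q S : lep Q S -> orthp P S -> orthp P Q.
Proof. by move=> QS PS x; rewrite -QS PS. Qed.

Lemma lep_orthp_compl P Q : orthoproj P -> orthoproj Q -> orthp P (compl Q) -> lep P Q.
Proof.
move=> Pp Qp PQ; apply: adj_lep => // x.
by have /eqP := PQ x; rewrite /compl orthoprojB// subr_eq0 => /eqP.
Qed.

Lemma orthp_lep_compl P Q : orthp Q P -> lep P (compl Q).
Proof. by move=> QP x; rewrite /compl QP subr0. Qed.

Lemma orthoproj_addp P Q : orthoproj P -> orthoproj Q -> orthp P Q -> orthoproj (addp P Q).
Proof.
move=> Pp Qp PQ; have QP := orthp_sym Pp Qp PQ.
split=> [x y|x]; rewrite /addp.
  by rewrite dotDl dotDr (proj1 Pp) (proj1 Qp).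
by rewrite (orthoprojD Pp) (orthoprojD Qp) PQ QP addr0 add0r (proj2 Pp) (proj2 Qp).
Qed.

Lemma lep_addl P Q : orthoproj P -> orthoproj Q -> orthp P Q -> lep P (addp P Q).
Proof. by move=> Pp Qp /(orthp_sym Pp Qp) QP x; rewrite /addp QP (proj2 Pp) addr0. Qed.

Lemma lep_addr P Q : orthoproj Q -> orthp P Q -> lep Q (addp P Q).
Proof. by move=> Qp PQ x; rewrite /addp PQ (proj2 Qp) add0r. Qed.

Lemma addp_lep P Q S : orthoproj S -> lep P S -> lep Q S -> lep (addp P Q) S.
Proof. by move=> Sp PS QS x; rewrite /addp orthoprojD// PS QS. Qed.

Lemma orthoproj_subp P Q : orthoproj P -> orthoproj Q -> lep Q P -> orthoproj (subp P Q).
Proof.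
move=> Pp Qp QP; split=> [x y|x]; rewrite /subp.
  by rewrite dotBl dotBr (proj1 Pp) (proj1 Qp).
rewrite (orthoprojB Pp) (orthoprojB Qp) (proj2 Pp) (proj2 Qp) QP.
by rewrite (lep_adj Qp Pp QP) subrr subr0.
Qed.

Lemma orthp_subp P Q : orthoproj P -> orthoproj Q -> lep Q P -> orthp Q (subp P Q).
Proof.
move=> Pp Qp QP x.
by rewrite /subp orthoprojB// (lep_adj Qp Pp QP) (proj2 Qp) subrr.
Qed.

Lemma subpK P Q : addp Q (subp P Q) = P.
Proof. by apply/funext => x; rewrite /addp /subp addrC subrK. Qed.

Lemma orthoproj_line x : dot x x = 1 -> orthoproj (line x).
Proof.
move=> x1; split=> [u v|u]; rewrite /line; last by rewrite dotZl x1 mulr1.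
by rewrite dotZl dotZr -dotC mulrC.
Qed.

Lemma orthp_line P x : orthoproj P -> P x = 0 -> orthp P (line x).
Proof. by move=> Pp Px u; rewrite /line orthoprojZ// Px scaler0. Qed.

Lemma lineE x : dot x x = 1 -> line x x = x.
Proof. by move=> x1; rewrite /line x1 scale1r. Qed.

Lemma lep_line P x : orthoproj P -> P x = x -> lep (line x) P.
Proof. by move=> Pp Px u; rewrite /line orthoprojZ// Px. Qed.

(* For a linear subspace A this says that A is infinite-dimensional. *)
Definition large A : Prop :=
  forall s : seq H, exists x, [/\ A x, dot x x = 1 & forall t, t \in s -> dot x t = 0].

(** The counterpart of [P_infty] in a bare inner product space, where no norm is at hand. *)
Definition pinf P : Prop :=
  [/\ orthoproj P, large [set x | P x = x] & large [set x | P x = 0]].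

Definition orthonormal_seq (z : nat -> H) : Prop :=
  forall m n, dot (z m) (z n) = (m == n)%:R.

Lemma large_subset A B : (A `<=` B)%classic -> large A -> large B.
Proof. by move=> AB lA s; have [x [Ax x1 xs]] := lA s; exists x; split=> //; exact: AB. Qed.

Lemma orthonormal_seq_comp (z : nat -> H) (g : nat -> nat) :
  injective g -> orthonormal_seq z -> orthonormal_seq (z \o g).
Proof. by move=> g_inj zo m n; rewrite /= zo (inj_eq g_inj). Qed.

(** Recursive choice: [p n] lists [s] and the first [n] chosen vectors, to which the next one is
    taken orthogonal. The set may vary with [n], so that one sequence can alternate between two
    ranges. *)
Lemma large_orthonormal_seq (A : nat -> set H) (s : seq H) : (forall n, large (A n)) ->
  exists2 z : nat -> H, orthonormal_seq z &
    (forall n, A n (z n)) /\ (forall n t, t \in s -> dot (z n) t = 0).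
Proof.
move=> lA.
have [g gP] : exists g : nat -> seq H -> H, forall n s', [/\ A n (g n s'),
    dot (g n s') (g n s') = 1 & forall t, t \in s' -> dot (g n s') t = 0].
  have [g gP] := choice (fun ns => lA ns.1 ns.2).
  by exists (fun n s' => g (n, s')) => n s'; exact: gP (n, s').
pose p := fix p n := if n is k.+1 then g k (p k) :: p k else s.
have sp t n : t \in s -> t \in p n.
  by move=> ts; elim: n => //= n IH; rewrite inE IH orbT.
have lt_p m n : (m < n)%N -> g m (p m) \in p n.
  elim: n => // n IH; rewrite ltnS leq_eqVlt => /predU1P[->|/IH h] /=.
    by rewrite mem_head.
  by rewrite inE h orbT.
exists (fun n => g n (p n)); last split.
- move=> m n; case: (ltngtP m n) => [mn|nm|->].
  + by apply: dot_eq0C; have [_ _] := gP n (p n); apply; exact: lt_p.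
  + by have [_ _] := gP m (p m); apply; exact: lt_p.
  + by have [] := gP n (p n).
- by move=> n; have [] := gP n (p n).
- by move=> n t ts; have [_ _] := gP n (p n); apply; exact: sp.
Qed.

Lemma orthonormal_seq_large (z : nat -> H) A : orthonormal_seq z ->
  (forall n (c : 'I_n -> C), A (\sum_(i < n) c i *: z i)) -> large A.
Proof.
move=> zo Az s; pose n := size s.
(* There are [n + 1] coefficients for [n] orthogonality conditions, so some nonzero combination of
   the first [n + 1] vectors is orthogonal to all of [s]. *)
pose M : 'M[C]_(n.+1, n) := \matrix_(i, j) dot (z i) (nth 0 s j).
have : kermx M != 0.
  by rewrite -mxrank_eq0 mxrank_ker -lt0n subn_gt0 ltnS rank_leq_col.
case/rowV0Pn => v /sub_kermxP vM v0.
pose x := \sum_(i < n.+1) v 0 i *: z i.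
have xz (i : 'I_n.+1) : dot x (z i) = v 0 i.
  rewrite dot_suml (bigD1 i)//= big1 => [|j ji]; rewrite dotZl zo.
    by rewrite eqxx mulr1 addr0.
  by rewrite (inj_eq val_inj) (negPf ji) mulr0.
have x0 : x != 0.
  apply: contraNneq v0 => x0; apply/eqP/rowP => i.
  by rewrite -xz x0 dot0l mxE.
exists ((sqrtC (dot x x))^-1 *: x); split; last 2 first.
- exact: dot_normalize.
- move=> t ts; rewrite dotZl; apply/eqP; rewrite mulf_eq0; apply/orP; right.
  have it : (index t s < n)%N by rewrite index_mem.
  have /rowP/(_ (Ordinal it)) := vM; rewrite !mxE => <-.
  rewrite dot_suml; apply/eqP/eq_bigr => i _.
  by rewrite dotZl !mxE /= nth_index.
- rewrite scaler_sumr; under eq_bigr do rewrite scalerA; exact: Az.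
Qed.

Lemma pinf_of_orthonormal_seqs P (z z' : nat -> H) : orthoproj P ->
  orthonormal_seq z -> orthonormal_seq z' ->
  (forall n, P (z n) = z n) -> (forall n, P (z' n) = 0) -> pinf P.
Proof.
move=> Pp zo zo' Pz Pz'; split=> //.
- apply: (orthonormal_seq_large zo) => n c /=; rewrite orthoproj_sum//.
  by apply: eq_bigr => i _; rewrite orthoprojZ// Pz.
- apply: (orthonormal_seq_large zo') => n c /=; rewrite orthoproj_sum//.
  by apply: big1 => i _; rewrite orthoprojZ// Pz' scaler0.
Qed.

Lemma pinf_orthoproj P : pinf P -> orthoproj P.
Proof. by case. Qed.

Lemma pinf_compl P : pinf P -> pinf (compl P).
Proof.
move=> [Pp lP lP']; split; first exact: orthoproj_compl.
- by apply: large_subset lP' => x /= Px; rewrite /compl Px subr0.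
- by apply: large_subset lP => x /= Px; rewrite /compl Px subrr.
Qed.

Lemma pinf_between P S T : orthoproj P -> pinf S -> pinf T -> lep S P -> lep P T -> pinf P.
Proof.
move=> Pp [Sp lS _] [Tp _ lT] SP PT; split=> //.
- by apply: large_subset lS => x /= Sx; rewrite -[in LHS]Sx SP.
- by apply: large_subset lT => x /= Tx; rewrite -(lep_adj Pp Tp PT) Tx orthoproj0.
Qed.

Lemma pinf_add_line P x : pinf P -> P x = 0 -> dot x x = 1 -> pinf (addp P (line x)).
Proof.
move=> [Pp lP lP'] Px x1.
have Plx := orthp_line Pp Px; have xp := orthoproj_line x1.
split; first exact: orthoproj_addp.
- by apply: large_subset lP => u /= Pu; rewrite -[u in LHS]Pu lep_addl.
- move=> s; have [u [/= Pu u1 us]] := lP' (x :: s); exists u; split=> //.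
    by rewrite /= /addp Pu add0r /line us ?mem_head// scale0r.
  by move=> t ts; rewrite us// inE ts orbT.
Qed.

End Projections.

(** * Maps of projections that preserve orthogonality and attained angles *)

Section AngleMaps.
Context {C : numClosedFieldType} {H : lmodType C}.
Variable dot : {dot H for @Num.conj C}.
Implicit Types (x y z u v w : H) (a : C) (P Q S T : H -> H).

(** A pair at which the minimal angle between the two ranges is attained: the smallest angle is the
    largest modulus. *)
Definition max_pair P Q x y : Prop :=
  [/\ P x = x, Q y = y, dot x x = 1, dot y y = 1 &
   forall u v, P u = u -> Q v = v -> dot u u = 1 -> dot v v = 1 ->
     `|dot u v| <= `|dot x y|].

Lemma max_pair_add_line P Q x y : orthoproj dot P -> orthoproj dot Q ->
  orthp P Q -> dot x x = 1 -> dot y y = 1 -> P x = 0 -> P y = 0 -> Q x = 0 -> Q y = 0 ->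
  max_pair (addp P (line dot x)) (addp Q (line dot y)) x y.
Proof.
move=> Pp Qp PQ x1 y1 Px Py Qx Qy; split=> //.
- by rewrite /addp Px lineE// add0r.
- by rewrite /addp Qy lineE// add0r.
move=> u v Pu Qv u1 v1.
have le1 w z : dot w w = 1 -> dot z z = 1 -> `|dot w z| <= 1.
  move=> w1 z1; rewrite -(@expr_le1 _ 2)//.
  by rewrite (le_trans (cauchy_schwarz dot w z))// w1 z1 mulr1.
(* Only the components along [x] and [y] interact, since [P] and [Q] are orthogonal to each other
   and to both vectors. The first two factors have modulus at most 1. *)
have -> : dot u v = dot u x * Num.conj (dot v y) * dot x y.
  rewrite -[u in LHS]Pu -[v in LHS]Qv /addp /line dotDl !dotDr !dotZl !dotZr.
  rewrite !(proj1 Pp) PQ Py !dot0r.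
  rewrite -(proj1 Qp) Qx dot0l !mulr0 !add0r.
  by rewrite mulrA.
by rewrite !normrM norm_conjC ler_piMl// mulr_ile1// le1.
Qed.

Hypothesis large_setT : large dot [set: H].
(** The form in which completeness is used: orthogonal projection onto the closed span of a
    sequence. *)
Hypothesis span_proj : forall z : nat -> H, orthonormal_seq dot z ->
  exists P, [/\ orthoproj dot P, forall n, P (z n) = z n &
    forall u, (forall n, dot u (z n) = 0) -> P u = 0].

Lemma span_between (z : nat -> H) : orthonormal_seq dot z ->
  exists P, [/\ orthoproj dot P, forall n, P (z n) = z n,
    forall u, (forall n, dot u (z n) = 0) -> P u = 0,
    forall Q, orthoproj dot Q -> (forall n, Q (z n) = z n) -> lep P Q &
    forall Q, orthoproj dot Q -> (forall n, Q (z n) = 0) -> orthp Q P].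
Proof.
move=> /span_proj[P [Pp Pz Pz']]; exists P; split=> // Q Qp Qz.
- apply: (adj_lep Pp Qp) => x; apply/eqP; rewrite -subr_eq0 -(orthoprojB Pp).
  by apply/eqP/Pz' => n; rewrite dotBl (proj1 Qp) Qz subrr.
- apply: (orthp_sym Pp Qp) => x; apply: Pz' => n.
  by rewrite (proj1 Qp) Qz dot0r.
Qed.

(** [F] is total on maps but constrained only on [pinf], and angles are compared only when attained
    on both sides. *)
Variable F : (H -> H) -> (H -> H).
Local Notation pinf := (pinf dot).
Hypothesis F_pinf : forall P, pinf P -> pinf (F P).
Hypothesis F_surj : forall Q, pinf Q -> exists2 P, pinf P & F P = Q.
Hypothesis F_orth : forall P Q, pinf P -> pinf Q -> orthp P Q <-> orthp (F P) (F Q).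
Hypothesis F_angle : forall P Q x y x' y', pinf P -> pinf Q ->
  max_pair P Q x y -> max_pair (F P) (F Q) x' y' -> `|dot x' y'| = `|dot x y|.

(** * Order, complements and sums under [F] *)

Let pp P : pinf P -> orthoproj dot P. Proof. exact: pinf_orthoproj. Qed.
Let Fpp P : pinf P -> orthoproj dot (F P). Proof. by move/F_pinf/pp. Qed.

(** Order is orthogonality to a complement. Forwards, the complement of [F Q] is reached as some
    [F T] by surjectivity; backwards, [compl Q] itself serves. *)
Lemma F_lep P Q : pinf P -> pinf Q -> lep P Q <-> lep (F P) (F Q).
Proof.
move=> Pi Qi; split=> PQ.
- have [T Ti FT] := F_surj (pinf_compl (F_pinf Qi)).
  apply: (lep_orthp_compl (Fpp Pi) (Fpp Qi)); rewrite -FT.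
  apply/(F_orth Pi Ti); apply: (orthp_sym (pp Ti) (pp Pi)); apply: orthp_lep PQ _.
  apply: (orthp_sym (pp Qi) (pp Ti)); apply/(F_orth Qi Ti); rewrite FT.
  exact: (orthp_compl (Fpp Qi)).
- apply: (lep_orthp_compl (pp Pi) (pp Qi)).
  have Ci := pinf_compl Qi.
  apply/(F_orth Pi Ci); apply: (orthp_sym (Fpp Ci) (Fpp Pi)); apply: orthp_lep PQ _.
  apply/(F_orth Ci Qi); apply: (orthp_sym (pp Qi) (pp Ci)).
  exact: (orthp_compl (pp Qi)).
Qed.

(** [compl P] is the largest projection orthogonal to [P], a description that [F] respects. *)
Lemma F_compl P : pinf P -> F (compl P) = compl (F P).
Proof.
move=> Pi; have Ci := pinf_compl Pi; have FCi := pinf_compl (F_pinf Pi).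
apply: (lep_anti (Fpp Ci) (pp FCi)).
  apply: orthp_lep_compl; apply/(F_orth Pi Ci).
  exact: (orthp_compl (pp Pi)).
have [T Ti FT] := F_surj FCi; rewrite -FT; apply/(F_lep Ti Ci).
apply: orthp_lep_compl; apply/(F_orth Pi Ti); rewrite FT.
exact: (orthp_compl (Fpp Pi)).
Qed.

(** An orthogonal sum is a least upper bound. The sum of the images lies between [F P] and
    [F (addp P Q)], hence is in [pinf] and has a preimage. *)
Lemma F_addp P Q : pinf P -> pinf Q -> orthp P Q -> pinf (addp P Q) ->
  F (addp P Q) = addp (F P) (F Q).
Proof.
move=> Pi Qi PQ PQi; have FPQ := (F_orth Pi Qi).1 PQ.
have FPQp := orthoproj_addp (Fpp Pi) (Fpp Qi) FPQ.
have lF : lep (addp (F P) (F Q)) (F (addp P Q)).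
  apply: (addp_lep (Fpp PQi)).
    by apply/(F_lep Pi PQi); exact: (lep_addl (pp Pi) (pp Qi)).
  by apply/(F_lep Qi PQi); exact: (lep_addr (pp Qi)).
have lP := lep_addl (Fpp Pi) (Fpp Qi) FPQ.
have FPQi : pinf (addp (F P) (F Q)) by apply: pinf_between lF; rewrite //; exact: F_pinf.
apply: (lep_anti (Fpp PQi) FPQp) => //.
have [T Ti FT] := F_surj FPQi; rewrite -FT; apply/(F_lep PQi Ti).
apply: (addp_lep (pp Ti)).
  by apply/(F_lep Pi Ti); rewrite FT.
by apply/(F_lep Qi Ti); rewrite FT; exact: (lep_addr (Fpp Qi)).
Qed.

(** A preimage [T] of [F Q] plus the line of [y] lies between [Q] and [Q] plus the line of [x]. It
    maps [x] to [c *: x] with [c] idempotent, so it is one of these two; the first is excluded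
    because [F Q] kills [y]. *)
Lemma F_add_line Q x y : pinf Q -> Q x = 0 -> dot x x = 1 -> dot y y = 1 ->
  F (addp Q (line dot x)) y = y -> F Q y = 0 ->
  F (addp Q (line dot x)) = addp (F Q) (line dot y).
Proof.
move=> Qi Qx x1 y1 Fy Fy0; have Qxi := pinf_add_line Qi Qx x1.
have FQyi := pinf_add_line (F_pinf Qi) Fy0 y1.
have [T Ti FT] := F_surj FQyi.
have Qlp := orthp_line (pp Qi) Qx; have xp := orthoproj_line x1.
have FQlp := orthp_line (Fpp Qi) Fy0; have yp := orthoproj_line y1.
have QT : lep Q T.
  by apply/(F_lep Qi Ti); rewrite FT; exact: (lep_addl (Fpp Qi) yp).
have TQ : lep T (addp Q (line dot x)).
  apply/(F_lep Ti Qxi); rewrite FT; apply: (addp_lep (Fpp Qxi)).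
    by apply/(F_lep Qi Qxi); exact: (lep_addl (pp Qi) xp).
  exact: (lep_line (Fpp Qxi)).
have TE u : T u = Q u + dot u x *: T x.
  rewrite -[LHS](lep_adj (pp Ti) (pp Qxi) TQ) /addp (orthoprojD (pp Ti)) QT.
  by rewrite /line (orthoprojZ (pp Ti)).
have TxE : T x = dot (T x) x *: x.
  have := TQ x; rewrite /addp -[Q (T x)]/(Q (T x)) (lep_adj (pp Qi) (pp Ti) QT) Qx add0r.
  by move=> {1}<-.
set c := dot (T x) x in TxE.
have cc : c * c = c.
  have := proj2 (pp Ti) x; rewrite TxE (orthoprojZ (pp Ti)) TxE scalerA => h.
  by have := congr1 (fun t => dot t x) h; rewrite !dotZl x1 !mulr1.
have : c * (c - 1) = 0 by rewrite mulrBr cc mulr1 subrr.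
move/eqP; rewrite mulf_eq0 subr_eq0 => /orP[]/eqP c01.
- have TQE : T = Q by apply/funext => u; rewrite TE TxE c01 scale0r scaler0 addr0.
  have := congr1 (fun T => T y) FT; rewrite TQE /addp Fy0 lineE// add0r => /esym y0.
  by have /eqP := unit_neq0 y1; rewrite y0.
- rewrite -FT; congr F; apply/funext => u.
  by rewrite TE TxE c01 scale1r.
Qed.

(** * The relation between lines induced by [F] *)

Definition line_image x y : Prop := forall P, pinf P -> P x = 0 -> F P y = 0.

(* For P orthogonal to x, the condition "y lies in F (P + x) and is orthogonal
   to F P" does not depend on P: it passes from Q to a subprojection S of Q,
   then up to S + T for T in the range of P orthogonal to S, then down to T,
   and up to P. *)
Let image_at x y Q := F (addp Q (line dot x)) y = y /\ F Q y = 0.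

Let addp_lineAC P Q x :
  addp (addp P Q) (line dot x) = addp (addp P (line dot x)) Q.
Proof. by apply/funext => u; rewrite /addp addrAC. Qed.

Let orth_add_line P Q x : orthoproj dot P -> orthoproj dot Q -> dot x x = 1 ->
  orthp P Q -> Q x = 0 -> orthp (addp P (line dot x)) Q.
Proof.
move=> Pp Qp x1 PQ Qx u; rewrite /addp PQ add0r.
by rewrite (orthp_sym Qp (orthoproj_line x1) (orthp_line Qp Qx)).
Qed.

Let image_up x y P Q : dot x x = 1 -> pinf P -> pinf Q -> pinf (addp P Q) -> orthp P Q ->
  P x = 0 -> Q x = 0 -> image_at x y P -> image_at x y (addp P Q).
Proof.
move=> x1 Pi Qi PQi PQ Px Qx [y1 y0].
have PQx : addp P Q x = 0 by rewrite /addp Px Qx addr0.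
have Pxi := pinf_add_line Pi Px x1; have PQxi := pinf_add_line PQi PQx x1.
have PxQ := orth_add_line (pp Pi) (pp Qi) x1 PQ Qx.
split.
- have /(F_lep Pxi PQxi) Fl : lep (addp P (line dot x)) (addp (addp P Q) (line dot x)).
    by rewrite addp_lineAC; exact: (lep_addl (pp Pxi) (pp Qi)).
  by rewrite -[y in LHS]y1 Fl y1.
- rewrite F_addp// /addp y0 add0r -[y]y1.
  by have /(F_orth Qi Pxi)-> := orthp_sym (pp Pxi) (pp Qi) PxQ.
Qed.

(** [F] splits off [F Q] from the image of the enlarged sum, and [F Q] kills [y] because it lies
    below [F (addp P Q)]. *)
Let image_down x y P Q : dot x x = 1 -> pinf P -> pinf Q -> pinf (addp P Q) -> orthp P Q ->
  P x = 0 -> Q x = 0 -> image_at x y (addp P Q) -> image_at x y P.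
Proof.
move=> x1 Pi Qi PQi PQ Px Qx [y1 y0].
have PQx : addp P Q x = 0 by rewrite /addp Px Qx addr0.
have Pxi := pinf_add_line Pi Px x1; have PQxi := pinf_add_line PQi PQx x1.
have PxQ := orth_add_line (pp Pi) (pp Qi) x1 PQ Qx.
have sub0 T : pinf T -> lep T (addp P Q) -> F T y = 0.
  move=> Ti /(F_lep Ti PQi) Fl.
  by rewrite -(lep_adj (Fpp Ti) (Fpp PQi) Fl) y0 (orthoproj0 (Fpp Ti)).
have Py0 := sub0 _ Pi (lep_addl (pp Pi) (pp Qi) PQ).
have Qy0 := sub0 _ Qi (lep_addr (pp Qi) PQ).
split=> //; move: y1; rewrite addp_lineAC F_addp//; last by rewrite -addp_lineAC.
by rewrite {1}/addp Qy0 addr0.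
Qed.

Lemma image_at_line_image Q x y : pinf Q -> Q x = 0 -> dot x x = 1 ->
  F (addp Q (line dot x)) y = y -> F Q y = 0 -> line_image x y.
Proof.
move=> Qi Qx x1 Fy Fy0 P Pi Px.
(* Even terms lie in the range of [Q], odd ones in that of [P]. Modulo 4, class 0 spans [S] below
   [Q] and class 1 spans [T] below [P]; classes 2 and 3 keep [Q - S] and [P - T]
   infinite-dimensional, and class 2 also lies in the kernel of [S + T]. *)
have [|z zo [zA _]] := @large_orthonormal_seq _ _ dot
  (fun n => [set u | (if odd n then P u else Q u) = u]) [::].
  by move=> n; case: (odd n); [case: Pi|case: Qi].
have zo4 j : orthonormal_seq dot (fun k => z (4 * k + j)%N).
  apply: (orthonormal_seq_comp (g := fun k => 4 * k + j)%N) zo.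
  by move=> m n /addIn /eqP; rewrite eqn_mul2l /= => /eqP.
have odd4 k j : odd (4 * k + j) = odd j by rewrite oddD oddM.
have zQ k j : ~~ odd j -> Q (z (4 * k + j)%N) = z (4 * k + j)%N.
  by move=> oj; have /= := zA (4 * k + j)%N; rewrite odd4 (negPf oj).
have zP k j : odd j -> P (z (4 * k + j)%N) = z (4 * k + j)%N.
  by move=> oj; have /= := zA (4 * k + j)%N; rewrite odd4 oj.
have zz i j k l : (i < 4)%N -> (j < 4)%N -> i != j ->
    dot (z (4 * k + i)%N) (z (4 * l + j)%N) = 0.
  move=> i4 j4 ij; rewrite zo; case: eqP => // /(congr1 (modn^~ 4)).
  by rewrite ![(4 * _)%N]mulnC !modnMDl !modn_small// => /eqP; rewrite (negPf ij).
have [S [Sp Sz Sz' Sl So]] := span_between (zo4 0).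
have [T [Tp Tz Tz' Tl To]] := span_between (zo4 1).
have Sz0 j k : (0 < j < 4)%N -> S (z (4 * k + j)%N) = 0.
  by case/andP=> j0 j4; apply: Sz' => n; rewrite zz// -lt0n.
have Tz0 j k : (j < 4)%N -> j != 1 -> T (z (4 * k + j)%N) = 0.
  by move=> j4 j1; apply: Tz' => n; rewrite zz.
have SQ : lep S Q by apply: (Sl _ (pp Qi)) => n; exact: zQ.
have TP : lep T P by apply: (Tl _ (pp Pi)) => n; exact: zP.
have TS : orthp T S by apply: (So _ Tp) => n; exact: Tz0.
have ST : orthp S T := orthp_sym Tp Sp TS.
have Si : pinf S.
  by apply: (pinf_of_orthonormal_seqs Sp (zo4 0) (zo4 1)) => // n; rewrite Sz0.
have Ti : pinf T.
  by apply: (pinf_of_orthonormal_seqs Tp (zo4 1) (zo4 0)) => // n; rewrite Tz0.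
have STi : pinf (addp S T).
  apply: (pinf_of_orthonormal_seqs (orthoproj_addp Sp Tp ST) (zo4 0) (zo4 2)) => n.
    by rewrite /addp Sz Tz0// addr0.
  by rewrite /addp Sz0// Tz0// addr0.
have QSi : pinf (subp Q S).
  apply: (pinf_of_orthonormal_seqs (orthoproj_subp (pp Qi) Sp SQ) (zo4 2) (zo4 0)) => n.
    by rewrite /subp zQ// Sz0// subr0.
  by rewrite /subp zQ// Sz subrr.
have PTi : pinf (subp P T).
  apply: (pinf_of_orthonormal_seqs (orthoproj_subp (pp Pi) Tp TP) (zo4 3) (zo4 1)) => n.
    by rewrite /subp zP// Tz0// subr0.
  by rewrite /subp zP// Tz subrr.
have Sx : S x = 0 by rewrite -(lep_adj Sp (pp Qi) SQ) Qx (orthoproj0 Sp).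
have Tx : T x = 0 by rewrite -(lep_adj Tp (pp Pi) TP) Px (orthoproj0 Tp).
have imS : image_at x y S.
  apply: (@image_down x y S (subp Q S)); rewrite ?subpK//.
  - exact: (orthp_subp (pp Qi) Sp SQ).
  - by rewrite /subp Qx Sx subrr.
have imST : image_at x y (addp S T) by apply: image_up.
have imT : image_at x y T.
  have addST : addp S T = addp T S by apply/funext => u; rewrite /addp addrC.
  by apply: (@image_down x y T S) => //; rewrite -addST.
have [] // : image_at x y P.
rewrite -(subpK P T); apply: image_up; rewrite ?subpK//.
- exact: (orthp_subp (pp Pi) Tp TP).
- by rewrite /subp Px Tx subrr.
Qed.

Lemma pinf_orth (s : seq H) :
  exists P Q, [/\ pinf P, pinf Q, orthp P Q & forall x, x \in s -> P x = 0 /\ Q x = 0].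
Proof.
(* The sequence is orthogonal to [s]. Its classes 1 and 0 modulo 3 span the two projections, each
   class lying in the kernel of the other projection. *)
have [//|z zo [_ zs]] := @large_orthonormal_seq _ _ dot (fun=> setT) s.
have zo3 j : orthonormal_seq dot (fun k => z (3 * k + j)%N).
  apply: (orthonormal_seq_comp (g := fun k => 3 * k + j)%N) zo.
  by move=> m n /addIn /eqP; rewrite eqn_mul2l /= => /eqP.
have zz i j k l : (i < 3)%N -> (j < 3)%N -> i != j ->
    dot (z (3 * k + i)%N) (z (3 * l + j)%N) = 0.
  move=> i4 j4 ij; rewrite zo; case: eqP => // /(congr1 (modn^~ 3)).
  by rewrite ![(3 * _)%N]mulnC !modnMDl !modn_small// => /eqP; rewrite (negPf ij).
have [S [Sp Sz Sz' _ So]] := span_between (zo3 0).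
have [T [Tp Tz Tz' _ _]] := span_between (zo3 1).
exists T, S; split.
- apply: (pinf_of_orthonormal_seqs Tp (zo3 1) (zo3 0)) => // n.
  by apply: Tz' => k; rewrite zz.
- apply: (pinf_of_orthonormal_seqs Sp (zo3 0) (zo3 1)) => // n.
  by apply: Sz' => k; rewrite zz.
- by apply: (So _ Tp) => n; apply: Tz' => k; rewrite zz.
- by move=> x xs; split; [apply: Tz'|apply: Sz'] => n; apply: dot_eq0C; exact: zs.
Qed.

Lemma line_imageZ x y a b : a != 0 -> line_image x y -> line_image (a *: x) (b *: y).
Proof.
move=> a0 xy P Pi; rewrite (orthoprojZ (pp Pi)) => /eqP.
rewrite scaler_eq0 (negPf a0) => /eqP /(xy _ Pi) h.
by rewrite (orthoprojZ (Fpp Pi)) h scaler0.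
Qed.

Lemma line_image_exists x : dot x x = 1 -> exists2 y, dot y y = 1 & line_image x y.
Proof.
move=> x1; have [Q [Q' [Qi _ _ Q0]]] := pinf_orth [:: x].
have [Qx _] := Q0 x (mem_head _ _); have Qxi := pinf_add_line Qi Qx x1.
have ln := lep_addl (pp Qi) (orthoproj_line x1) (orthp_line (pp Qi) Qx).
have Fl := (F_lep Qi Qxi).1 ln.
(* If the two images agreed, [F] would reflect the order and put the larger projection below [Q],
   which fails at [x]. *)
have [u u0] : exists u, F (addp Q (line dot x)) u - F Q u != 0.
  apply: contrapT => /forallNP h.
  have FE : F (addp Q (line dot x)) = F Q.
    by apply/funext => u; apply/eqP; rewrite -subr_eq0; apply: contrapT => /negP/h.
  have /(F_lep Qxi Qi)/(_ x) : lep (F (addp Q (line dot x))) (F Q).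
    by rewrite FE; exact: lep_refl (Fpp Qi).
  rewrite /addp Qx lineE// add0r Qx => /esym x0.
  by have /eqP := unit_neq0 x1.
set w := _ - _ in u0; exists ((sqrtC (dot w w))^-1 *: w); first exact: dot_normalize.
apply: (image_at_line_image Qi Qx x1).
- rewrite (orthoprojZ (Fpp Qxi)) /w (orthoprojB (Fpp Qxi)).
  by rewrite (proj2 (Fpp Qxi)) Fl.
- rewrite (orthoprojZ (Fpp Qi)) /w (orthoprojB (Fpp Qi)).
  by rewrite (proj2 (Fpp Qi)) (lep_adj (Fpp Qi) (Fpp Qxi) Fl) subrr scaler0.
Qed.

Lemma line_image_add_line Q x y : dot x x = 1 -> dot y y = 1 -> line_image x y ->
  pinf Q -> Q x = 0 -> F (addp Q (line dot x)) = addp (F Q) (line dot y).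
Proof.
move=> x1 y1 xy Qi Qx; have Qxi := pinf_add_line Qi Qx x1.
apply: F_add_line => //; last exact: xy.
(* [x] is killed by the complement of the enlarged projection, so [y] is killed by the complement of
   its image, that is, fixed by the image. *)
have := xy _ (pinf_compl Qxi); rewrite F_compl// /compl {1}/addp Qx lineE// add0r subrr.
by move=> /(_ erefl)/eqP; rewrite subr_eq0 => /eqP.
Qed.

Lemma line_image_dot x1 x2 y1 y2 :
  dot x1 x1 = 1 -> dot x2 x2 = 1 -> dot y1 y1 = 1 -> dot y2 y2 = 1 ->
  line_image x1 y1 -> line_image x2 y2 -> `|dot y1 y2| = `|dot x1 x2|.
Proof.
move=> x11 x21 y11 y21 xy1 xy2.
have [P [Q [Pi Qi PQ PQ0]]] := pinf_orth [:: x1; x2].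
have [[Px1 Qx1] [Px2 Qx2]] : (P x1 = 0 /\ Q x1 = 0) /\ (P x2 = 0 /\ Q x2 = 0).
  by split; apply: PQ0; rewrite !inE eqxx ?orbT.
have FPQ := (F_orth Pi Qi).1 PQ.
apply: (@F_angle (addp P (line dot x1)) (addp Q (line dot x2))).
- exact: pinf_add_line.
- exact: pinf_add_line.
- by apply: max_pair_add_line => //; exact: pp.
- rewrite (line_image_add_line x11 y11)// (line_image_add_line x21 y21)//.
  by apply: max_pair_add_line => //; (try exact: Fpp); (exact: xy1 || exact: xy2).
Qed.

Lemma line_image_fun : exists f : H -> H, forall x, line_image x (f x) /\
  forall y, `|dot (f x) (f y)| = `|dot x y|.
Proof.
have ex x : exists y, dot x x = 1 -> dot y y = 1 /\ line_image x y.
  have [/line_image_exists[y y1 xy]|x1] := pselect (dot x x = 1); first by exists y.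
  by exists 0.
have [g gP] := choice ex.
(* [g] is meaningful on unit vectors only; it is extended by scaling with the norm [r x], which
   gives 0 at 0. *)
pose r x := sqrtC (dot x x); pose n x := (r x)^-1 *: x.
have rn x : x = r x *: n x.
  have [->|x0] := eqVneq x 0; first by rewrite /n !scaler0.
  by rewrite /n scalerA divff ?scale1r// sqrtC_eq0 dnorm_eq0.
have r0 : r 0 = 0 by rewrite /r dot0l sqrtC0.
exists (fun x => r x *: g (n x)) => x; split.
  have [->|x0] := eqVneq x 0.
    by rewrite r0 scale0r => P Pi _; rewrite (orthoproj0 (Fpp Pi)).
  rewrite [X in line_image X](rn x); apply: line_imageZ.
    by rewrite sqrtC_eq0 dnorm_eq0.
  by have [] := gP _ (dot_normalize dot x0).
move=> y; have [->|x0] := eqVneq x 0; first by rewrite r0 scale0r !dot0l.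
have [->|y0] := eqVneq y 0; first by rewrite r0 scale0r !dot0r.
have [gx1 gx] := gP _ (dot_normalize dot x0); have [gy1 gy] := gP _ (dot_normalize dot y0).
rewrite dotZl dotZr [in RHS](rn x) [in RHS](rn y) [in RHS]dotZl [in RHS]dotZr !normrM.
by rewrite (line_image_dot (dot_normalize dot x0) (dot_normalize dot y0) gx1 gy1 gx gy).
Qed.

(** * The operator that implements [F] *)

Theorem angle_map_intertwined : exists U : H -> H,
  [/\ linear U /\ (forall x y, dot (U x) (U y) = dot x y) \/
      (forall a x y, U (a *: x + y) = Num.conj a *: U x + U y) /\
      (forall x y, dot (U x) (U y) = dot y x),
      forall y, exists x, U x = y
    & forall P, pinf P -> forall x, F P (U x) = U (P x)].
Proof.
have [f fP] := line_image_fun.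
have [e [_ e1 _]] := large_setT [::].
have [U [U_lin U_f]] := wigner (fun x y => proj2 (fP x) y) e1.
have UD x y : U (x + y) = U x + U y.
  rewrite -[x in LHS]scale1r.
  by case: U_lin => -[-> _]; rewrite ?rmorph1 scale1r.
have Uxx x : dot (U x) (U x) = dot x x by case: U_lin => -[_ ->].
have U0 : U 0 = 0 by apply: (@dotxx_eq0 _ _ dot); rewrite Uxx dot0l.
have UZ a x : exists b, U (b *: x) = a *: U x.
  case: U_lin => -[UZ _].
    by exists a; have := UZ a x 0; rewrite U0 !addr0.
  by exists (Num.conj a); have := UZ (Num.conj a) x 0; rewrite U0 !addr0 conjCK.
have Uim x P : pinf P -> P x = 0 -> F P (U x) = 0.
  move=> Pi Px; have [c ->] := U_f x.
  by rewrite (orthoprojZ (Fpp Pi)) (proj1 (fP x))// scaler0.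
have UP P : pinf P -> forall x, F P (U x) = U (P x).
  move=> Pi x; rewrite -[x in LHS](subrK (P x)) UD (orthoprojD (Fpp Pi)).
  rewrite Uim ?add0r//; last by rewrite (orthoprojB (pp Pi)) (proj2 (pp Pi)) subrr.
  have := @Uim (P x) _ (pinf_compl Pi); rewrite F_compl// /compl.
  rewrite (proj2 (pp Pi)) subrr => /(_ erefl)/eqP.
  by rewrite subr_eq0 => /eqP/esym.
exists U; split=> // y.
have [->|y0] := eqVneq y 0; first by exists 0.
suff [x x0 [c Ux]] : exists2 x, x != 0 & exists c, U x = c *: y.
  have c0 : c != 0.
    apply: contraNneq x0 => c0; rewrite -(dnorm_eq0 dot) -Uxx Ux c0 scale0r.
    by rewrite dot0l.
  have [b bE] := UZ c^-1 x; exists (b *: x).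
  by rewrite bE Ux scalerA mulVf// scale1r.
(* For surjectivity, [S] and [S] plus the line of [y] are pulled back to [Q] and [P]. A nonzero
   vector in the range of [P - Q] is then sent by [U] into the line of [y], by the intertwining
   relation for both. *)
have [S [S' [Si _ _ S0]]] := pinf_orth [:: y].
have [Sy _] := S0 y (mem_head _ _).
set w := (sqrtC (dot y y))^-1 *: y; have w1 : dot w w = 1 := dot_normalize dot y0.
have Sw : S w = 0 by rewrite (orthoprojZ (pp Si)) Sy scaler0.
have Swi := pinf_add_line Si Sw w1.
have [P Pi FP] := F_surj Swi; have [Q Qi FQ] := F_surj Si.
have QP : lep Q P.
  apply/(F_lep Qi Pi); rewrite FP FQ.
  exact: (lep_addl (pp Si) (orthoproj_line w1) (orthp_line (pp Si) Sw)).
have [u u0] : exists u, P u - Q u != 0.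
  apply: contrapT => /forallNP h.
  have PQ : P = Q by apply/funext => u; apply/eqP; rewrite -subr_eq0; apply: contrapT => /negP/h.
  have := congr1 (fun T => T w) FP; rewrite PQ FQ /addp Sw lineE// add0r => /esym w0.
  by have /eqP := unit_neq0 w1.
exists (P u - Q u) => //.
have := UP _ Pi (P u - Q u); have := UP _ Qi (P u - Q u).
rewrite (orthoprojB (pp Pi)) (orthoprojB (pp Qi)) (proj2 (pp Pi)) (proj2 (pp Qi)).
rewrite QP (lep_adj (pp Qi) (pp Pi) QP) subrr U0 FP FQ /addp => -> .
rewrite add0r /line /w scalerA => <-.
by eexists.
Qed.

End AngleMaps.

(** * Norm and limits in the Hilbert space *)

Section Hilbert.
Context {R : realType} {H : completeNormedModType R[i]}.
Variable dot : {dot H for @Num.conj R[i]}.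
Hypothesis norm_dot : forall x : H, `|x| ^+ 2 = dot x x.
Implicit Types (x y z u v : H) (P Q : H -> H).

Lemma ge0_ReE (c : R[i]) : 0 <= c -> c = (complex.Re c)%:C.
Proof. by move=> c0; rewrite [LHS]complexE (ger0_Im c0) mulr0 addr0. Qed.

Lemma norm_dot_le x y : `|dot x y| <= `|x| * `|y|.
Proof.
rewrite -(@ler_pXn2r _ 2)// ?nnegrE ?mulr_ge0//.
by rewrite exprMn !norm_dot; exact: cauchy_schwarz.
Qed.

Lemma norm_eq1 x : `|x| = 1 <-> dot x x = 1.
Proof.
rewrite -norm_dot; split=> [->|/eqP]; first by rewrite expr1n.
by rewrite sqrf_eq1 => /orP[/eqP//|/eqP x1]; have := normr_ge0 x; rewrite x1 oppr_ge0 ler10.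
Qed.

Lemma cvg_dot_eq (u v : nat -> H) l m x y : (u @ \oo --> l)%classic ->
  (v @ \oo --> m)%classic -> (forall n, dot (u n) y = dot x (v n)) ->
  dot l y = dot x m.
Proof.
move=> ul vm uv; apply/eqP; rewrite -subr_eq0; apply/negPn/negP => d0.
(* The difference turns out to be at most [e * (|x| + |y|)]; the extra 1 in the denominator makes
   this strictly smaller than the difference itself. *)
pose e := `|dot l y - dot x m| / (`|x| + `|y| + 1).
have K0 : 0 < `|x| + `|y| + 1 by rewrite ltr_wpDl// addr_ge0.
have e0 : 0 < e by rewrite divr_gt0// normr_gt0.
move/cvgrPdist_lt/(_ _ e0) : ul => ul; move/cvgrPdist_lt/(_ _ e0) : vm => vm.
have [n [un vn]] := filter_ex (filterI ul vm).
have : `|dot l y - dot x m| <= e * (`|x| + `|y|).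
  have -> : dot l y - dot x m = dot (l - u n) y - dot x (m - v n).
    by rewrite dotBl dotBr uv opprB addrA subrK.
  rewrite (le_trans (ler_normB _ _))// mulrDr addrC lerD//.
    by rewrite (le_trans (norm_dot_le _ _))// mulrC ler_wpM2r// ltW.
  by rewrite (le_trans (norm_dot_le _ _))// ler_wpM2r// ltW.
have {1}-> : `|dot l y - dot x m| = e * (`|x| + `|y| + 1) by rewrite divfK ?gt_eqF.
by rewrite ler_pM2l// gerDl ler10.
Qed.

(** * Projection onto the closed span of an orthonormal sequence, by Fourier series *)

Section SpanProjection.
Variable z : nat -> H.
Hypothesis zo : orthonormal_seq dot z.

Let fourier x k : H := dot x (z k) *: z k.

Let fourier_dot x y m n :
  dot (\sum_(m <= k < n) fourier x k) y = dot x (\sum_(m <= k < n) fourier y k).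
Proof.
rewrite dot_suml dot_sumr; apply: eq_bigr => k _.
by rewrite dotZl dotZr -dotC mulrC.
Qed.

Let fourier_z x m n k : (m <= k < n)%N -> dot (\sum_(m <= j < n) fourier x j) (z k) = dot x (z k).
Proof.
move=> mkn; rewrite dot_suml (bigD1_seq k) ?mem_index_iota ?iota_uniq//=.
rewrite big1 ?addr0 => [|j jk]; rewrite dotZl zo; first by rewrite eqxx mulr1.
by rewrite (negPf jk) mulr0.
Qed.

Let fourier_norm x m n : dot (\sum_(m <= k < n) fourier x k) (\sum_(m <= k < n) fourier x k)
  = \sum_(m <= k < n) `|dot x (z k)| ^+ 2.
Proof.
rewrite [LHS]dot_sumr; apply: eq_big_nat => k kmn.
by rewrite dotZr fourier_z// normCK mulrC.
Qed.

(** The difference of the two sides is the squared norm of [x] minus its partial Fourier sum. *)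
Let bessel x n : \sum_(0 <= k < n) `|dot x (z k)| ^+ 2 <= dot x x.
Proof.
rewrite -subr_ge0; set s := \sum_(0 <= k < n) fourier x k.
suff -> : dot x x - \sum_(0 <= k < n) `|dot x (z k)| ^+ 2 = dot (x - s) (x - s).
  exact: dnorm_ge0.
have sx : dot s x = dot s s.
  rewrite [RHS]dot_sumr dot_suml; apply: eq_big_nat => k kn.
  by rewrite dotZl dotZr /s fourier_z// -dotC mulrC.
rewrite -fourier_norm -/s dotBl !dotBr sx (dotC dot x s) sx dot_conjxx.
by rewrite subrr subr0.
Qed.

(** The squared norm of a block of the series is a block of the real series [v], which is
    nondecreasing and bounded by Bessel's inequality, hence Cauchy. *)
Let fourier_cvg x : cvg (series (fourier x) @ \oo)%classic.
Proof.
apply: cauchy_cvg; apply/cauchy_seriesP => e e0.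
pose v k : R := complex.Re (`|dot x (z k)| ^+ 2).
have vE k : `|dot x (z k)| ^+ 2 = (v k)%:C by apply: ge0_ReE; rewrite exprn_ge0.
have v0 k : 0 <= v k by rewrite -lecR -vE exprn_ge0.
have vsum m n : \sum_(m <= k < n) `|dot x (z k)| ^+ 2 = (\sum_(m <= k < n) v k)%:C.
  by rewrite rmorph_sum; apply: eq_bigr => k _; exact: vE.
have cv : cvg (series v @ \oo)%classic.
  apply: nondecreasing_is_cvgn.
    by apply/nondecreasing_seqP => n; rewrite /series /= big_nat_recr//= lerDl.
  exists (complex.Re (dot x x)) => _ [n _ <-].
  by rewrite /series /= -lecR -vsum -ge0_ReE ?dnorm_ge0//; exact: bessel.
have eE := ge0_ReE (ltW e0); have re0 : 0 < complex.Re e by rewrite -ltcR -eE.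
have vc : cauchy (series (v : nat -> R^o) @ \oo)%classic by exact: cvg_cauchy.
have vC := (cauchy_seriesP _).1 vc.
have := vC _ (exprn_gt0 2 re0); apply: filterS => -[m n] /= mn.
rewrite -(@ltr_pXn2r _ 2)// ?nnegrE ?(ltW e0)// norm_dot fourier_norm vsum eE.
by rewrite -rmorphXn ltcR (le_lt_trans _ mn)// ler_norm.
Qed.

Lemma span_proj : exists P, [/\ orthoproj dot P, forall n, P (z n) = z n &
  forall u, (forall n, dot u (z n) = 0) -> P u = 0].
Proof.
pose P x : H := lim (series (fourier x) @ \oo)%classic.
have near_cst x l N : (forall n, (N <= n)%N -> series (fourier x) n = l) -> P x = l.
  move=> xl; apply: cvg_lim; first exact: norm_hausdorff.
  by apply: cvg_near_cst; exists N.
have Padj x y : dot (P x) y = dot x (P y).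
  by apply: (cvg_dot_eq (@fourier_cvg x) (@fourier_cvg y)) => n; exact: fourier_dot.
have Pz n : P (z n) = z n.
  apply: (near_cst _ _ n.+1) => k nk; rewrite /series /= (bigD1_seq n) ?iota_uniq//=; last first.
    by rewrite mem_index_iota.
  rewrite big1 /fourier ?zo ?eqxx ?scale1r ?addr0// => j jn.
  by rewrite zo eq_sym (negPf jn) scale0r.
exists P; split=> //.
- split=> // x; rewrite [LHS]/(lim (series (fourier (P x)) @ \oo)%classic).
  (* Idempotence: moving [P] onto [z k], which it fixes, shows that [P x] and [x] have the same
     Fourier coefficients. *)
  suff -> : fourier (P x) = fourier x by [].
  by apply/funext => k; rewrite /fourier Padj Pz.
- move=> u uz; apply: (near_cst _ _ 0%N) => n _.
  by rewrite /series /= big1// => k _; rewrite /fourier uz scale0r.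
Qed.

End SpanProjection.

(** * Infinite dimension and projections in terms of the inner product *)

(** By contraposition and induction on [s]: if only 0 in [A] is orthogonal to [s], then [A] is
    finite-dimensional. Dropping [t] replaces [A] by its subspace [B] orthogonal to [t], and [A] is
    [B] or [B] plus the line of one vector [a]. *)
Lemma infinite_dim_large (A : set H) : A 0 ->
  (forall a x y, A x -> A y -> A (a *: x + y)) -> infinite_dim A -> large dot A.
Proof.
move=> A0 Alin Ainf s; apply: contrapT => nA; apply: Ainf.
have {nA} : forall x, A x -> (forall t, t \in s -> dot x t = 0) -> x = 0.
  move=> x Ax xs; apply/eqP/negPn/negP => x0; apply: nA.
  exists ((sqrtC (dot x x))^-1 *: x); split; last 2 first.
  - exact: dot_normalize.
  - by move=> t ts; rewrite dotZl (xs t)// mulr0.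
  by rewrite -[_ *: _]addr0; exact: Alin.
elim: s A A0 Alin => [|t s IH] A A0 Alin As.
  exists 0%N, (fun=> 0); apply/seteqP; split=> [x Ax|_ [c _ <-]].
    by exists (fun=> 0) => //; rewrite big_ord0; apply/esym/As.
  by rewrite big_ord0.
pose B := [set x | A x /\ dot x t = 0].
have [||x [Ax xt] xs|n [e Be]] := IH B.
- by split=> //; rewrite dot0l.
- move=> a x y [Ax xt] [Ay yt]; split; first exact: Alin.
  by rewrite dotDl dotZl xt yt mulr0 addr0.
- by apply: As => // t'; rewrite inE => /predU1P[->//|/xs].
have [AB|/existsNP[a /not_implyP[Aa at0]]] := pselect (forall x, A x -> dot x t = 0).
  exists n, e; rewrite -Be; apply/seteqP; split=> x; last by case.
  by move=> Ax; split=> //; exact: AB.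
exists n.+1, (fun i => oapp e a (unlift ord_max i)).
apply/seteqP; split=> [x Ax|_ [c _ <-]].
- have : B (x - (dot x t / dot a t) *: a).
    split; last by rewrite dotBl dotZl divfK ?subrr//; apply/eqP.
    by rewrite addrC -scaleNr; exact: Alin.
  rewrite Be => -[c _ cE].
  exists (fun i => oapp c (dot x t / dot a t) (unlift ord_max i)) => //.
  rewrite big_ord_recr /= unlift_none /= -[RHS](subrK ((dot x t / dot a t) *: a)) -cE.
  congr (_ + _); apply: eq_bigr => i _.
  have -> : widen_ord (leqnSn n) i = lift ord_max i.
    by apply: val_inj; rewrite /= /bump leqNgt ltn_ord.
  by rewrite liftK.
- rewrite big_ord_recr /= unlift_none /= addrC; apply: Alin => //.
  suff [] : B (\sum_(i < n) c (widen_ord (leqnSn n) i) *: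
     oapp e a (unlift ord_max (widen_ord (leqnSn n) i))) by [].
  rewrite Be; exists (fun i => c (widen_ord (leqnSn n) i)) => //.
  apply: eq_bigr => i _.
  have -> : widen_ord (leqnSn n) i = lift ord_max i.
    by apply: val_inj; rewrite /= /bump leqNgt ltn_ord.
  by rewrite liftK.
Qed.

Lemma large_infinite_dim (A : set H) : large dot A -> infinite_dim A.
Proof.
move=> lA [n [e Ae]].
have [x [+ x1 xe]] := lA [seq e i | i <- enum 'I_n].
rewrite Ae => -[c _ cx]; have /eqP := unit_neq0 x1; apply.
apply: (@dotxx_eq0 _ _ dot); rewrite -{2}cx dot_sumr big1// => i _.
by rewrite dotZr xe ?mulr0//; apply: map_f; rewrite mem_enum.
Qed.

Lemma is_projectionP P : is_projection dot P <-> orthoproj dot P.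
Proof.
split=> [[_ [_ Padj] PP]|[Padj PP]]; first by split=> // x; exact: PP.
have Pp : orthoproj dot P by [].
have Plin := orthoproj_linear Pp.
split=> //; split=> //; exists 1 => x; rewrite mul1r.
(* The bound 1 comes from Pythagoras. *)
rewrite -(@ler_pXn2r _ 2)// ?nnegrE// !norm_dot -subr_ge0.
suff -> : dot x x - dot (P x) (P x) = dot (x - P x) (x - P x) by exact: dnorm_ge0.
by rewrite dotBl !dotBr !Padj PP subrr subr0.
Qed.

Lemma range_orthoproj P : orthoproj dot P -> range P = [set x | P x = x].
Proof.
move=> [_ PP]; apply/seteqP; split=> [_ [x _ <-]|x /= Px]; first exact: PP.
by exists x.
Qed.

Lemma unit_vectors_range P x : orthoproj dot P ->
  unit_vectors (range P) x <-> P x = x /\ dot x x = 1.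
Proof.
move=> Pp; rewrite range_orthoproj//.
by split=> -[Px x1]; split=> //; exact/norm_eq1.
Qed.

Lemma P_inftyP P : P_infty dot P <-> pinf dot P.
Proof.
split=> [[/is_projectionP Pp Pr Pk]|[Pp Pr Pk]].
- split=> //; apply: infinite_dim_large; rewrite /= ?(orthoproj0 Pp)//.
  + by move=> a x y Px Py; rewrite (orthoproj_linear Pp) Px Py.
  + by rewrite -range_orthoproj.
  + by move=> a x y Px Py; rewrite (orthoproj_linear Pp) Px Py scaler0 addr0.
- split; first exact/is_projectionP.
  + by rewrite range_orthoproj//; exact: large_infinite_dim.
  + exact: large_infinite_dim.
Qed.

(** * Angles and their infima *)

Lemma ler_ReN (a b : R[i]) : `|a| <= `|b| -> complex.Re `|a| <= complex.Re `|b|.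
Proof. by rewrite lecE => /andP[]. Qed.

Lemma Re_norm_itv x y : dot x x = 1 -> dot y y = 1 ->
  complex.Re `|dot x y| \in `[0, 1].
Proof.
move=> /norm_eq1 x1 /norm_eq1 y1; have := norm_dot_le x y; have := normr_ge0 (dot x y).
by rewrite x1 y1 mulr1 !lecE in_itv /= => /andP[_ ->] /andP[_ ->].
Qed.

Lemma le_acos : {in `[0, 1] &, {mono @acos R : s t /~ s <= t}}.
Proof.
move=> s t; rewrite !in_itv /= => /andP[s0 s1] /andP[t0 t1].
have itv1 (r : R) : 0 <= r -> r <= 1 -> -1 <= r <= 1.
  by move=> r0 ->; rewrite (le_trans _ r0)// lerN10.
have acos_itv (r : R) : -1 <= r <= 1 -> acos r \in `[0, pi].
  by move=> h; rewrite in_itv /= acos_ge0// acos_lepi.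
have [sN tN] := (itv1 _ s0 s1, itv1 _ t0 t1).
by rewrite !leNgt -ltr_cos ?acos_itv// !acosK ?in_itv.
Qed.

Lemma inf_angle_le P Q x y : orthoproj dot P -> orthoproj dot Q ->
  P x = x -> Q y = y -> dot x x = 1 -> dot y y = 1 -> inf_angle dot P Q <= angle dot x y.
Proof.
move=> Pp Qp Px Qy x1 y1; apply: ge_inf.
  exists 0 => _ [u /(unit_vectors_range _ Pp)[_ u1] [v /(unit_vectors_range _ Qp)[_ v1] <-]].
  have := Re_norm_itv u1 v1; rewrite in_itv /= => /andP[r0 r1].
  by rewrite acos_ge0// r1 (le_trans _ r0)// lerN10.
by exists x; [exact/unit_vectors_range|exists y => //; exact/unit_vectors_range].
Qed.

Lemma inf_angle_max_pair P Q x y : orthoproj dot P -> orthoproj dot Q ->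
  max_pair dot P Q x y -> inf_angle dot P Q = angle dot x y.
Proof.
move=> Pp Qp [Px Qy x1 y1 xy]; apply/eqP; rewrite eq_le inf_angle_le//=.
apply: lb_le_inf.
  exists (angle dot x y).
  by exists x; [exact/unit_vectors_range|exists y => //; exact/unit_vectors_range].
move=> _ [u /(unit_vectors_range _ Pp)[Pu u1] [v /(unit_vectors_range _ Qp)[Qv v1] <-]].
rewrite /angle le_acos ?Re_norm_itv//.
by apply: ler_ReN; exact: xy.
Qed.

Lemma max_pair_angle_inj P Q P' Q' x y x' y' :
  orthoproj dot P -> orthoproj dot Q -> orthoproj dot P' -> orthoproj dot Q' ->
  inf_angle dot P Q = inf_angle dot P' Q' ->
  max_pair dot P Q x y -> max_pair dot P' Q' x' y' -> `|dot x' y'| = `|dot x y|.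
Proof.
move=> Pp Qp Pp' Qp' + m m'.
rewrite (inf_angle_max_pair Pp Qp m) (inf_angle_max_pair Pp' Qp' m') /angle => h.
case: m m' => [_ _ x1 y1 _] [_ _ x1' y1' _].
have {}h : complex.Re `|dot x y| = complex.Re `|dot x' y'|.
  have [r r'] := (Re_norm_itv x1 y1, Re_norm_itv x1' y1').
  by apply/eqP; rewrite eq_le -(le_acos r' r) -(le_acos r r') h lexx.
by rewrite [LHS]ge0_ReE// [RHS]ge0_ReE// h.
Qed.

(** [acos 0] is the right angle, kept in this form so that monotonicity of [acos] turns the bound on
    angles into vanishing moduli. *)
Lemma orthp_inf_angle P Q : pinf dot P -> pinf dot Q ->
  orthp P Q <-> inf_angle dot P Q = acos 0.
Proof.
move=> [Pp Pl _] [Qp Ql _]; split=> [PQ|PQ0].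
- have dot0 u v : P u = u -> Q v = v -> dot u v = 0.
    by move=> <- <-; rewrite (proj1 Pp) PQ dot0r.
  have [[x [/= Px x1 _]] [y [/= Qy y1 _]]] := (Pl [::], Ql [::]).
  rewrite (@inf_angle_max_pair P Q x y)// /angle ?dot0// ?normr0//.
  by split=> // u v Pu Qv _ _; rewrite dot0// normr0.
- have dot0 u v : P u = u -> Q v = v -> dot u u = 1 -> dot v v = 1 -> dot u v = 0.
    move=> Pu Qv u1 v1; have := inf_angle_le Pp Qp Pu Qv u1 v1.
    rewrite PQ0 /angle le_acos ?Re_norm_itv// ?in_itv /= ?lexx ?ler01// => h.
    apply/eqP; rewrite -normr_le0 lecE h andbT ger0_Im//.
  (* Otherwise the unit vectors along [P (Q x)] and [Q x] are not orthogonal, as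
     [dot (P (Q x)) (Q x)] is the squared norm of [P (Q x)]. *)
  move=> x; apply/eqP/negPn/negP => PQx.
  have Qx : Q x != 0 by apply: contraNneq PQx => ->; rewrite (orthoproj0 Pp).
  have := dot0 _ _ _ _ (dot_normalize dot PQx) (dot_normalize dot Qx).
  rewrite (orthoprojZ Pp) (orthoprojZ Qp) (proj2 Pp) (proj2 Qp) => /(_ erefl erefl)/eqP.
  rewrite dotZl dotZr !mulf_eq0 conjC_eq0 !invr_eq0 !sqrtC_eq0 !dnorm_eq0.
  rewrite (negPf PQx) (negPf Qx) /= => /eqP h; move/negP: PQx; apply.
  by apply/eqP/(@dotxx_eq0 _ _ dot); rewrite -(proj1 Pp) (proj2 Pp).
Qed.

End Hilbert.

Theorem proposition1p1 (R : realType) (H : completeNormedModType R[i])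
    (dot : {dot H for @Num.conj R[i]})
    (norm_dot : forall x : H, `|x| ^+ 2 = dot x x)
    (H_infinite : infinite_dim [set: H])
    (H_separable : separable H)
    (phi : P_infty dot -> P_infty dot)
    (phi_surj : set_surj [set: P_infty dot] [set: P_infty dot] phi)
    (phi_angle : forall P Q : P_infty dot,
      inf_angle dot (\val P) (\val Q)
      = inf_angle dot (\val (phi P)) (\val (phi Q))) :
  exists U U' : H -> H,
    (unitary dot U /\ is_adjoint dot U U' \/
     antiunitary dot U /\ is_antiadjoint dot U U') /\
    forall P : P_infty dot, \val (phi P) = U \o \val P \o U'.
Proof.
(* [phi] is extended to all maps by the identity outside [P_infty]; only values on [P_infty] are
   ever examined. *)
pose F P := if pselect (P_infty dot P) is left h
  then \val (phi (SigSub (mem_set h))) else P.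
have FE (P : P_infty dot) : F (\val P) = \val (phi P).
  rewrite /F; case: pselect => [h|]; last by case; exact: set_valP.
  by congr (\val (phi _)); exact: val_inj.
have valE P : pinf dot P -> exists P' : P_infty dot, P = \val P'.
  by move=> /(P_inftyP norm_dot) h; exists (SigSub (mem_set h)).
have pinf_val (P : P_infty dot) : pinf dot (\val P).
  by apply/(P_inftyP norm_dot); exact: set_valP.
have F_pinf P : pinf dot P -> pinf dot (F P) by move=> /valE[P' ->]; rewrite FE.
have F_surj Q : pinf dot Q -> exists2 P, pinf dot P & F P = Q.
  move=> /valE[Q' ->]; have [P _ <-] := phi_surj Q' I.
  by exists (\val P).
have F_inf P Q : pinf dot P -> pinf dot Q ->
    inf_angle dot P Q = inf_angle dot (F P) (F Q).
  by move=> /valE[P' ->] /valE[Q' ->]; rewrite !FE.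
have F_orth P Q : pinf dot P -> pinf dot Q -> orthp P Q <-> orthp (F P) (F Q).
  move=> Pi Qi; rewrite (orthp_inf_angle norm_dot Pi Qi).
  by rewrite (orthp_inf_angle norm_dot (F_pinf _ Pi) (F_pinf _ Qi)) F_inf.
have F_angle P Q x y x' y' : pinf dot P -> pinf dot Q -> max_pair dot P Q x y ->
    max_pair dot (F P) (F Q) x' y' -> `|dot x' y'| = `|dot x y|.
  move=> Pi Qi; apply: (max_pair_angle_inj norm_dot); last exact: F_inf.
  - exact: pinf_orthoproj Pi.
  - exact: pinf_orthoproj Qi.
  - exact: pinf_orthoproj (F_pinf _ Pi).
  - exact: pinf_orthoproj (F_pinf _ Qi).
have large_setT : large dot [set: H] by exact: infinite_dim_large.
have [U [U_lin U_surj UP]] := angle_map_intertwined large_setT (span_proj norm_dot)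
  F_pinf F_surj F_orth F_angle.
(* A right inverse of [U] is its adjoint, because [U] preserves the inner product up to
   conjugation. *)
have [U' UU'] := choice U_surj; exists U, U'; split; last first.
  by move=> P; rewrite -FE; apply/funext => x /=; rewrite -(UP _ (pinf_val P)) UU'.
case: U_lin => -[U_lin U_dot]; [left|right]; split; split=> //.
- by move=> y _; exists (U' y).
- move=> a x y; apply: (@dot_extl _ _ dot) => z.
  by rewrite -U_dot UU' !dotDl !dotZl -!(U_dot _ z) !UU'.
- by move=> x y; rewrite -[y in LHS]UU' U_dot.
- by move=> y _; exists (U' y).
- move=> a x y; apply: (@dot_extl _ _ dot) => z.
  by rewrite -U_dot UU' dotDr dotZr dotDl dotZl -!(U_dot z) !UU'.
- by move=> x y; rewrite -[y in LHS]UU' U_dot -dotC.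
Qed.
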